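(* Let $\gamma\ge 1$ and $n\ge 2\gamma$ be integers, and let $\mathscr{S}(n,\gamma)$ be the set of all $n$-vertex trees with domination number $\gamma$. Then among all trees in $\mathscr{S}(n,\gamma)$, the tree $A(n,\gamma)$ maximizes the total number of subtrees $F$, and it also maximizes the total number of leaf containing subtrees $F^*$. That is, $A(n,\gamma)\in\mathscr{S}(n,\gamma)$, and $F(T)\le F(A(n,\gamma))$ and $F^*(T)\le F^*(A(n,\gamma))$ for every $T\in\mathscr{S}(n,\gamma)$.
   Context: All graphs are finite and simple. A leaf of a tree is a vertex of degree $1$. A subtree of a tree $T$ is a (nonempty) connected induced subgraph of $T$. $F(T)$ denotes the number of subtrees of $T$, and $F^*(T)$ denotes the number of subtrees of $T$ that contain at least one leaf of $T$ (leaf containing subtrees). A dominating set of a graph $G$ is a set $S$ of vertices such that every vertex outside $S$ is adjacent to a vertex of $S$; the domination number of $G$ is the minimum cardinality of a dominating set (and for a connected graph of order $n\ge 2$ it is at most $n/2$). $K_{1,m}$ is the star with $m+1$ vertices. For $n\ge 2\gamma$, $A(n,\gamma)$ is the $n$-vertex tree obtained from the star $K_{1,n-\gamma}$ by choosing $\gamma-1$ of its pendant vertices and attaching one pendant edge to each of them. *)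

(* Defs.v *)
From mathcomp Require Import all_boot.
Set Implicit Arguments.
Unset Strict Implicit.
Unset Printing Implicit Defensive.

Structure sgraph := SGraph {
  svertex :> finType;
  sedge : rel svertex;
  sedge_sym : symmetric sedge;
  sedge_irrefl : irreflexive sedge
}.

Section Graphs.
Variable G : sgraph.
Implicit Types (x y : G) (S : {set G}).

Definition degree x : nat := #|[set y | sedge x y]|.

Definition leaf x : bool := degree x == 1.

Definition induced_edge S : rel G :=
  [rel u v | [&& u \in S, v \in S & sedge u v]].

(* Connectedness of the subgraph induced by S; the empty graph is excluded. *)
Definition connected S : bool :=
  (S != set0) && [forall x in S, forall y in S, connect (induced_edge S) x y].

(* The size bound is needed because [:: x; y] is a ucycle for every edge xy. *)
Definition acyclic : Prop :=
  forall c : seq G, 2 < size c -> ~~ ucycleb (@sedge G) c.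

Definition is_tree : Prop := connected [set: G] /\ acyclic.

Definition subtrees : {set {set G}} := [set S | connected S].

Definition leaf_subtrees : {set {set G}} :=
  [set S in subtrees | [exists x in S, leaf x]].

Definition num_subtrees : nat := #|subtrees|.

Definition num_leaf_subtrees : nat := #|leaf_subtrees|.

Definition dominating S : bool :=
  [forall x, (x \notin S) ==> [exists y in S, sedge x y]].

Definition domination_number : nat :=
  #|[arg min_(S < [set: G] | dominating S) #|S|]|.

End Graphs.

Definition tree_class (n gamma : nat) (T : sgraph) : Prop :=
  [/\ is_tree T, #|T| = n & domination_number T = gamma].

(* A(n, gamma) on the vertices 0, ..., n - 1, for 1 <= gamma and
   2 * gamma <= n: the centre of the star K_{1, n - gamma} is 0, its pendant
   vertices are 1, ..., n - gamma, and each i in 1, ..., gamma - 1 gets the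
   new pendant neighbour i + (n - gamma). The bound i < gamma follows from
   j < n in the second disjunct. *)
Definition A_arc (n gamma : nat) : rel 'I_n :=
  [rel i j : 'I_n | ((i == 0 :> nat) && (0 < j <= n - gamma))
                 || ((0 < i) && (j == i + (n - gamma) :> nat))].
Arguments A_arc : clear implicits.

(* The conjunct i != j only matters when n <= gamma, where n - gamma = 0. *)
Definition A_edge (n gamma : nat) : rel 'I_n :=
  [rel i j | (i != j) && (A_arc n gamma i j || A_arc n gamma j i)].
Arguments A_edge : clear implicits.

Lemma A_edge_sym n gamma : symmetric (A_edge n gamma).
Proof. by move=> i j; rewrite /A_edge /= eq_sym orbC. Qed.

Lemma A_edge_irrefl n gamma : irreflexive (A_edge n gamma).
Proof. by move=> i; rewrite /A_edge /= eqxx. Qed.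

Definition A_graph (n gamma : nat) : sgraph :=
  SGraph (@A_edge_sym n gamma) (@A_edge_irrefl n gamma).

(* Main.v *)
Require Import Defs.
From mathcomp Require Import all_boot zify.
Set Implicit Arguments.
Unset Strict Implicit.
Unset Printing Implicit Defensive.

(** Put gamma = h + 1 and n = 2 h + 1 + k. Every bound comes from taking the
    tree apart, down to a prescribed root r, by two kinds of step, each of
    which acts at a pendant vertex v with neighbour u:
    - delete v alone, when this does not lower the domination number (for
      instance because u has another pendant neighbour); then k drops by 1;
    - delete both v and u, when u has degree 2 and its other neighbour is w;
      the domination number drops by at most 1, so h drops by 1 and k stays.
    One of them is always available at the far end of a longest path that
    ends at r ([peel], [peel_ind]).

    Write F_r for the number of subtrees through r. The first step at most
    doubles it and the second at most triples it, so F_r <= 3 ^ h * 2 ^ k for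
    every root ([rooted_all_bound]). Deleting a pendant vertex from an
    unrooted count loses one singleton and subtrees through a neighbour, which
    the rooted bound controls; this gives F <= 3 ^ h * 2 ^ k + 3 h + k
    ([all_bound]).

    For subtrees that contain a leaf, fix a set M of marked pendant vertices
    with r outside M. A subtree that contains a deleted marked vertex is no
    longer constrained, hence it is counted by the unconstrained rooted
    bound; and in the second step u is unmarked, so that the step at most
    doubles the constrained count and adds the unconstrained one. The rooted
    count improves by 2 ^ h ([rooted_meet_bound]) and the unrooted one becomes
    3 ^ h * 2 ^ k - 2 ^ h + 2 h + k ([meet_bound]). Here M is the set of
    leaves of the tree and r any other vertex, which exists unless n = 2.

    In A(n, gamma), rooted at its centre, every step happens next to the root:
    u = r in the first and w = r in the second. All the estimates above are
    then equalities ([spider_counts_leaf], [spider_counts_path]), so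
    A(n, gamma) attains both bounds ([A_counts]). *)

Section Trees.
Variable G : sgraph.
Implicit Types (r u v w x y : G) (A D M Q S X : {set G}).

(** * Connected sets and pendant vertices *)

(** Connectedness as the absence of an empty cut: adding or deleting a pendant
    vertex changes cuts in a transparent way, whereas paths would have to be
    rerouted. *)
Lemma connected_cutP S :
  connected S <-> S != set0 /\
  (forall X, X \subset S -> X != set0 -> X != S ->
     exists x y, [/\ x \in X, y \in S, y \notin X & sedge x y]).
Proof.
split.
  case/andP=> S0 /forall_inP SC; split=> // X XS /set0Pn[a aX] XnS.
  have [b bS bX]: exists2 b, b \in S & b \notin X.
    by apply/subsetPn; apply: contra XnS => SX; rewrite eqEsubset XS.
  have aS := subsetP XS _ aX.
  have /connectP[p] := forall_inP (SC a aS) b bS.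
  elim: p a aX {aS} => [|c p IHp] a aX /=.
    by move=> _ ba; rewrite ba aX in bX.
  case/andP=> /and3P[_ cS ac] pc bc.
  have [cX | cX] := boolP (c \in X); first exact: IHp pc bc.
  by exists a, c.
case=> S0 cutS; rewrite /connected S0 /=.
apply/forall_inP=> x xS; apply/forall_inP=> y yS.
set X := [set z in S | connect (induced_edge S) x z].
have [XS | XS] := eqVneq X S.
  by move: yS; rewrite -[in X in X -> _]XS inE => /andP[].
have xX : x \in X by rewrite inE xS connect0.
have XsubS : X \subset S by apply/subsetP=> z; rewrite inE => /andP[].
have X0 : X != set0 by apply/set0Pn; exists x.
have [a [b [aX bS bX ab]]] := cutS X XsubS X0 XS.
move: aX bX; rewrite !inE bS => /andP[aS xa]; case/negP.
have E : induced_edge S a b by rewrite /induced_edge /= aS bS.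
by apply: connect_trans xa (connect1 E).
Qed.

Lemma connected1 x : connected [set x].
Proof.
apply/connected_cutP; split=> [|X]; first by apply/set0Pn; exists x; rewrite inE.
by rewrite subset1 => /orP[] /eqP->; rewrite eqxx.
Qed.

(** The trees that occur are induced on vertex sets A of one ambient graph, so
    being a leaf is relative to A. *)
Definition pendant A v u :=
  [/\ v \in A, u \in A, sedge v u & forall x, x \in A -> sedge v x -> x = u].

Lemma pendant_neq A v u : pendant A v u -> v != u.
Proof. by case=> _ _ vu _; apply/eqP=> E; rewrite E sedge_irrefl in vu. Qed.

(** A cut of S :\ v extends to S by putting v on the side of u, and the only
    edge at v does not cross it. *)
Lemma connected_del A S v u : pendant A v u -> S \subset A -> v \in S ->
  connected S -> S != [set v] -> (u \in S) /\ connected (S :\ v).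
Proof.
move=> [vA uA vu vN] SA vS /connected_cutP[S0 cutS] Sv.
have uS : u \in S.
  have [|||x [y [xv yS yv xy]]] := cutS [set v].
  - by rewrite sub1set.
  - by apply/set0Pn; exists v; rewrite inE.
  - by rewrite eq_sym.
  move: xv; rewrite inE => /eqP xv; rewrite xv in xy.
  by rewrite -(vN y) // (subsetP SA).
split=> //; apply/connected_cutP; split.
  apply/set0Pn; exists u; rewrite !inE uS andbT.
  by apply/eqP=> E; rewrite E sedge_irrefl in vu.
move=> X XS X0 XnS.
have vX : v \notin X by apply/negP=> /(subsetP XS); rewrite !inE eqxx.
have XsubS : X \subset S := subset_trans XS (subD1set _ _).
have [uX | uX] := boolP (u \in X).
  (* v joins the side of u, so the crossing edge found in S avoids v. *)
  have [|||x [y [xX yS yX xy]]] := cutS (v |: X).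
  - by rewrite subUset sub1set vS.
  - by apply/set0Pn; exists v; rewrite setU11.
  - apply: contra XnS => /eqP <-; rewrite setU1K //.
  move: xX yX; rewrite !inE negb_or => xX /andP[yv yX].
  exists x, y; rewrite !inE yv yS yX; split=> //.
  case/orP: xX => // /eqP xv; case/negP: yX.
  by rewrite (vN y) // -?xv // (subsetP SA).
have [|x [y [xX yS yX xy]]] := cutS X XsubS X0.
  by apply: contra vX => /eqP->.
exists x, y; rewrite !inE yS; split=> //; rewrite andbT.
apply: contra uX => /eqP yv; rewrite -(vN x) ?(subsetP SA) ?(subsetP XsubS) //.
by rewrite sedge_sym -yv.
Qed.

Lemma connected_add S v u : u \in S -> sedge v u -> connected S ->
  connected (v |: S).
Proof.
move=> uS vu /connected_cutP[S0 cutS]; apply/connected_cutP; split.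
  by apply/set0Pn; exists v; rewrite setU11.
move=> X XS X0 XnS.
have [XvS | XvS] := boolP (S \subset X).
  exists u, v; rewrite (subsetP XvS) // setU11 sedge_sym; split=> //.
  by apply: contra XnS => vX; rewrite eqEsubset XS subUset sub1set vX.
have [/setP XS0 | XS0] := eqVneq (X :&: S) set0.
  have XnotS x : x \in X -> x \in S = false.
    by move=> xX; have := XS0 x; rewrite !inE xX.
  exists v, u; rewrite !inE uS orbT; split=> //.
    case/set0Pn: X0 => x xX; have := subsetP XS x xX.
    by rewrite !inE XnotS // orbF => /eqP <-.
  by apply/negP=> /XnotS; rewrite uS.
have XnS' : X :&: S != S by apply: contra XvS => /eqP/setIidPr.
have [x [y [xX yS yX xy]]] := cutS (X :&: S) (subsetIr _ _) XS0 XnS'.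
exists x, y; move: xX yX; rewrite !inE yS orbT andbT => /andP[-> _] ->.
by split.
Qed.

(** * Counting connected sets *)

(** One family covers all the counts: Q = set0 or Q = [set r] for unrooted or
    rooted subtrees, M = setT or a set of leaves for all subtrees or those that
    contain a leaf. *)
Definition through Q A M :=
  [set S | [&& connected S, Q \subset S, S \subset A & ~~ [disjoint S & M]]].
Definition nsub Q A M := #|through Q A M|.

Lemma nsub_split Q A M v : v \notin Q ->
  nsub Q A M = nsub Q (A :\ v) M + nsub (v |: Q) A M.
Proof.
move=> vQ; rewrite /nsub.
rewrite -(cardsID [set S : {set G} | v \in S] (through Q A M)) addnC.
congr (_ + _); apply: eq_card => S; rewrite !inE.
  by rewrite subsetD1; case: (v \in S); rewrite ?andbF ?andbT //=.
by rewrite subUset sub1set; case: (v \in S); rewrite ?andbF ?andbT //=.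
Qed.

(** The requirement left on S :\ v when S contains v and must meet M: nothing
    remains to be asked once v itself is in M. *)
Definition join_all (b : bool) M := if b then setT else M.

(** S |-> S :\ v is a bijection onto connected sets through u; the singleton
    of v, which has no image, is the first summand. *)
Lemma nsub_pendant Q A M v u : pendant A v u -> v \notin Q ->
  nsub (v |: Q) A M = ((v \in M) && (Q == set0))
     + nsub (u |: Q) (A :\ v) (join_all (v \in M) M).
Proof.
move=> pvu vQ; rewrite /join_all; set M' := if _ then _ else _.
have [vA uA vu vN] := pvu.
pose f S := v |: S.
have finj : {in through (u |: Q) (A :\ v) M' &, injective f}.
  move=> S S'; rewrite !inE !subsetD1 => /and4P[_ _ /andP[_ vS] _].
  by case/and4P=> _ _ /andP[_ vS'] _ E; rewrite -(setU1K vS) -/(f S) E setU1K.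
rewrite /nsub -(card_in_imset finj).
have -> : ((v \in M) && (Q == set0) : nat)
    = #|if (v \in M) && (Q == set0) then [set [set v]] else set0|.
  by case: ifP; rewrite ?cards1 ?cards0.
rewrite -cardsUI [X in _ = _ + X]eq_card0 ?addn0; last first.
  move=> S; rewrite inE; case: ifP => _; rewrite !inE //.
  apply/negP=> /andP[/eqP-> /imsetP[S']]; rewrite inE subUset sub1set.
  case/and4P=> _ /andP[uS' _] _ _ E.
  have: u \in [set v] by rewrite E !inE uS' orbT.
  by rewrite inE => /eqP uv; rewrite uv sedge_irrefl in vu.
have disjE S : v \in S -> S != [set v] ->
    ~~ [disjoint S & M] = ~~ [disjoint S :\ v & M'] .
  move=> vS Sv; rewrite /M'; case: ifP => vM.
    have -> : ~~ [disjoint S & M] by apply/pred0Pn; exists v; rewrite /= vS.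
    have /subsetPn[x xS xv] : ~~ (S \subset [set v]).
      by rewrite subset1 negb_or Sv; apply/set0Pn; exists v.
    by apply/esym/pred0Pn; exists x; rewrite /= !inE xS !andbT -in_set1.
  congr (~~ _); apply/pred0P/pred0P => H x; have /= := H x; rewrite !inE.
    by case: (x \in S); rewrite ?andbF // => /= ->; rewrite andbF.
  by have [->|] := eqVneq x v; rewrite ?vM ?andbF.
apply: eq_card => S; rewrite !inE.
apply/idP/idP.
  rewrite subUset sub1set => /and4P[cS /andP[vS QS] SA SM].
  have [Sv | Sv] := eqVneq S [set v].
    apply/orP; left; have -> : Q == set0.
      apply/eqP/setP=> x; rewrite inE; apply/negP=> xQ.
      have := subsetP QS x xQ; rewrite Sv inE => /eqP xv.
      by rewrite xv (negbTE vQ) in xQ.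
    rewrite andbT; case: ifP => vM; first by rewrite inE Sv.
    move: SM; rewrite Sv; case/pred0Pn => x /= /andP[]; rewrite inE => /eqP->.
    by rewrite vM.
  apply/orP; right; apply/imsetP; exists (S :\ v); last by rewrite /f setD1K.
  have [uS cSv] := connected_del pvu SA vS cS Sv.
  rewrite inE cSv -disjE // SM setSD // subUset sub1set !inE uS andbT.
  by rewrite subsetD1 QS vQ eq_sym (pendant_neq pvu).
case/orP.
  case: ifP; rewrite inE // => /andP[vM /eqP->] /eqP->.
  rewrite connected1 setU0 subxx sub1set vA /=.
  by apply/pred0Pn; exists v; rewrite /= inE eqxx.
case/imsetP=> S'; rewrite inE subUset sub1set subsetD1.
case/and4P=> cS' /andP[uS' QS'] /andP[S'A vS'] S'M ->.
rewrite /f (connected_add uS') // setUS // subUset sub1set vA S'A /=.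
rewrite disjE ?setU11 ?setU1K //.
apply/eqP=> E; have: u \in [set v] by rewrite -E !inE uS' orbT.
by rewrite inE eq_sym (negbTE (pendant_neq pvu)).
Qed.

Lemma leq_nsub Q Q' A M M' : Q \subset Q' -> M' \subset M ->
  nsub Q' A M' <= nsub Q A M.
Proof.
move=> QQ' MM'; apply/subset_leq_card/subsetP=> S; rewrite !inE.
case/and4P=> -> Q'S -> SM; rewrite (subset_trans QQ' Q'S) /=.
by apply: contra SM; apply: disjointWr.
Qed.

Lemma set1_neq0 r : ([set r] == set0) = false.
Proof. by apply/negbTE/set0Pn; exists r; rewrite inE. Qed.

Lemma nsub_singleton Q M r : Q \subset [set r] -> nsub Q [set r] M = (r \in M).
Proof.
move=> Qr; rewrite /nsub.
have -> : (r \in M : nat) = #|if r \in M then [set [set r]] else set0|.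
  by case: ifP; rewrite ?cards1 ?cards0.
apply: eq_card => S; rewrite inE subset1.
have rM : ~~ [disjoint [set r] & M] = (r \in M).
  by rewrite disjoints1 negbK.
have [-> | Sr] := eqVneq S [set r].
  by rewrite connected1 Qr rM /=; case: ifP; rewrite inE ?eqxx.
have [-> | S0] := eqVneq S set0.
  rewrite /connected eqxx /=; case: ifP; rewrite inE //.
  by rewrite eq_sym set1_neq0.
by rewrite /= !andbF; case: ifP; rewrite inE // (negbTE Sr).
Qed.

Lemma in_join_all b M x : (x \in join_all b M) = b || (x \in M).
Proof. by case: b; rewrite ?inE. Qed.

Lemma join_allA b c M : join_all c (join_all b M) = join_all (b || c) M.
Proof. by case: b; case: c. Qed.

Lemma nsub_root_pendant A M r v u : pendant A v u -> r \in A :\ v ->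
  nsub [set r] A M = nsub [set r] (A :\ v) M
                  + nsub [set u; r] (A :\ v) (join_all (v \in M) M).
Proof.
move=> pvu rAv; have vnr : v \notin [set r].
  by move: rAv; rewrite !inE eq_sym => /andP[].
by rewrite (nsub_split _ _ vnr) (nsub_pendant _ pvu vnr) set1_neq0 andbF.
Qed.

Lemma nsub_all_pendant A M v u : pendant A v u ->
  nsub set0 A M = nsub set0 (A :\ v) M
               + ((v \in M) + nsub [set u] (A :\ v) (join_all (v \in M) M)).
Proof.
move=> pvu; have v0 : v \notin set0 by rewrite inE.
by rewrite (nsub_split _ _ v0) (nsub_pendant _ pvu v0) eqxx andbT setU0.
Qed.

Lemma nsub_root_path A M r v u w :
  pendant A v u -> pendant (A :\ v) u w -> r \in A :\ v :\ u ->
  nsub [set r] A M = nsub [set r] (A :\ v :\ u) M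
     + nsub [set w; r] (A :\ v :\ u) (join_all (u \in M) M)
     + nsub [set w; r] (A :\ v :\ u) (join_all ((v \in M) || (u \in M)) M).
Proof.
move=> pvu puw rA; have [ru rAv] : r != u /\ r \in A :\ v.
  by move: rA; rewrite 2!inE => /andP[].
have unr : u \notin [set r] by rewrite inE eq_sym.
rewrite (nsub_root_pendant _ pvu rAv) (nsub_root_pendant _ puw rA).
rewrite (nsub_pendant _ puw unr) set1_neq0 andbF.
by rewrite in_join_all join_allA orbA orbb.
Qed.

Lemma nsub_all_path A M v u w :
  pendant A v u -> pendant (A :\ v) u w ->
  nsub set0 A M = nsub set0 (A :\ v :\ u) M
     + ((u \in M) + nsub [set w] (A :\ v :\ u) (join_all (u \in M) M))
     + ((v \in M) + (((v \in M) || (u \in M))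
        + nsub [set w] (A :\ v :\ u) (join_all ((v \in M) || (u \in M)) M))).
Proof.
move=> pvu puw; have u0 : u \notin set0 by rewrite inE.
rewrite (nsub_all_pendant _ pvu) (nsub_all_pendant _ puw).
rewrite -[in nsub [set u] _ _](setU0 [set u]).
rewrite (nsub_pendant _ puw u0) eqxx andbT setU0.
by rewrite in_join_all join_allA orbA orbb.
Qed.

(** * Domination under deletion of vertices *)

Definition dominates A D :=
  D \subset A /\
  forall x, x \in A -> x \notin D -> exists2 y, y \in D & sedge x y.

(** A lower bound for the domination number of the subgraph induced on A: a
    lower bound is all that induction on A preserves. *)
Definition dom_ge A g := forall D, dominates A D -> g <= #|D|.

Lemma dom_ge1 A x : x \in A -> dom_ge A 1.
Proof.
move=> xA D [_ domD]; rewrite card_gt0; apply/set0Pn.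
have [xD | xD] := boolP (x \in D); first by exists x.
by have [y yD _] := domD x xA xD; exists y.
Qed.

(** Some minimum dominating set contains the common neighbour u of the twins,
    and such a set dominates v whether or not it was asked to: in a
    dominating set without u the twin v' can be traded for u. *)
Lemma dom_ge_twin A v v' u g : pendant A v u -> pendant A v' u -> v != v' ->
  dom_ge A g -> dom_ge (A :\ v) g.
Proof.
move=> pvu pv'u vv' gA D [DA domD].
have [vA uA vu vN] := pvu; have [v'A _ v'u v'N] := pv'u.
have [uv uv'] : u != v /\ u != v'.
  by rewrite ![u == _]eq_sym !(pendant_neq pvu, pendant_neq pv'u).
have DsubA : D \subset A := subset_trans DA (subD1set _ _).
have [uD | uD] := boolP (u \in D).
  apply: gA; split=> // x xA xD.
  have [->|xv] := eqVneq x v; first by exists u.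
  by apply: domD; rewrite // !inE xv.
have v'D : v' \in D.
  apply: contraR uD => v'D.
  have [|y yD v'y] := domD v' _ v'D; first by rewrite !inE v'A eq_sym vv'.
  by rewrite -(v'N y) // (subsetP DsubA).
have <- : #|u |: (D :\ v')| = #|D|.
  by rewrite (cardsD1 v' D) v'D cardsU1 !inE (negbTE uD) andbF.
apply: gA; split.
  by rewrite subUset sub1set uA (subset_trans (subD1set _ _)).
move=> x xA; rewrite !inE negb_or negb_and negbK => /andP[xu].
have [-> _ |xv' /= xD] := eqVneq x v'; first by exists u; rewrite ?inE ?eqxx.
have [-> | xv] := eqVneq x v; first by exists u; rewrite ?inE ?eqxx.
have [|y yD xy] := domD x _ xD; first by rewrite !inE xv.
exists y; rewrite // !inE yD andbT.
have [yv'|] := eqVneq y v'; rewrite ?orbT //.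
by case/eqP: xu; apply: v'N; rewrite // -yv' sedge_sym.
Qed.

(** Adding u to a dominating set of the rest dominates v and u as well. *)
Lemma dom_ge_path A v u g : pendant A v u ->
  dom_ge A g.+1 -> dom_ge (A :\ v :\ u) g.
Proof.
move=> [vA uA vu _] gA D [DA domD].
have uD : u \notin D by apply/negP=> /(subsetP DA); rewrite !inE eqxx.
have -> : #|D| = #|u |: D|.-1 by rewrite cardsU1 uD.
have: g < #|u |: D|; last by case: #|_|.
apply: gA; split.
  rewrite subUset sub1set uA; apply: (subset_trans DA).
  by apply/subsetP=> x; rewrite !inE => /and3P[].
move=> x xA; rewrite !inE negb_or => /andP[xu xD].
have [-> | xv] := eqVneq x v; first by exists u; rewrite ?inE ?eqxx.
have [|y yD xy] := domD x _ xD; first by rewrite !inE xu xv.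
by exists y; rewrite // !inE yD orbT.
Qed.

(** * Peeling a tree down to a root *)

(** A second neighbour of v on a path that starts at v would close a cycle. *)
Lemma acyclic_head v q x : acyclic G -> path (@sedge G) v q -> uniq (v :: q) ->
  x \in q -> sedge v x -> x = head v q.
Proof.
move=> acG + + xq; case/splitPr: xq => -[|y q1] q2 //= pq uq vx.
have: ~~ ucycleb (@sedge G) (v :: rcons (y :: q1) x).
  by apply: acG; rewrite /= size_rcons.
rewrite /ucycleb /cycle; case/negP; apply/andP; split.
  move: pq; rewrite cat_path /= => /and3P[vy pyq1 /andP[lx _]].
  by rewrite vy !rcons_path pyq1 lx last_rcons sedge_sym vx.
have -> : v :: rcons (y :: q1) x = take (size q1).+3 (v :: y :: q1 ++ x :: q2).
  by rewrite -cat_rcons -!cat_cons take_size_cat //= size_rcons.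
exact: take_uniq.
Qed.

(** Paths are listed from the far end to the root, so that extending one at
    the far end is a cons. *)
Definition rooted_path A r s :=
  if s is v :: q then
    [&& path (@sedge G) v q, last v q == r, uniq s & all [in A] s]
  else false.

Lemma rooted_path_max A r : r \in A ->
  exists2 s, rooted_path A r s &
    forall t, rooted_path A r t -> size t <= size s.
Proof.
move=> rA; pose P n := [exists t : n.-tuple G, rooted_path A r t].
have exP : exists n, P n.
  by exists 1; apply/existsP; exists [tuple r]; rewrite /= eqxx rA.
have leP n : P n -> n <= #|G|.
  case/existsP=> t rt; rewrite -(size_tuple t).
  suff /card_uniqP <- : uniq t by apply: max_card.
  by case: (val t) rt => // v q /and4P[].
case: (ex_maxnP exP leP) => n /existsP[s rs] maxn; exists s => // t rt.
by rewrite size_tuple maxn //; apply/existsP; exists (in_tuple t).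
Qed.

Lemma rooted_path_cons A r x v q : rooted_path A r (v :: q) -> x \in A ->
  sedge x v -> x \notin v :: q -> rooted_path A r (x :: v :: q).
Proof.
move=> /= /and4P[-> -> -> ->] -> ->; rewrite inE negb_or => /andP[-> ->].
by [].
Qed.

(** The last clause says that w is the root or has degree at least 2; it keeps
    w from being a marked leaf in [pendant_set_path]. *)
Definition peelable r A g := exists v u,
  [/\ pendant A v u, v != r &
      dom_ge (A :\ v) g \/
      exists w, [/\ u != r, pendant (A :\ v) u w &
                   (w == r) || [exists z in A, (z != u) && sedge w z]]].

(** Let v, u, w, ... be a longest path in A towards r. By maximality and
    acyclicity v is pendant, and so is any neighbour of u off the path, since
    it can replace v. Such a neighbour is a twin of v; without one, u has
    degree 2. If the path has length 1, then A is a star with centre r and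
    domination number 1, which deleting v cannot lower. *)
Lemma peel r A g : acyclic G -> connected A -> r \in A -> A != [set r] ->
  dom_ge A g -> peelable r A g.
Proof.
move=> acG /connected_cutP[A0 cutA] rA Ar gA.
have [s rs maxs] := rooted_path_max rA.
have nbr_head v q x : rooted_path A r (v :: q) -> size (v :: q) = size s ->
    x \in A -> sedge v x -> x = head v q.
  move=> rvq szs xA vx; have /and4P[pq lq uq aq] := rvq.
  apply: acyclic_head (vx) => //; apply: contraLR (leqnn (size s)) => xq.
  (* A neighbour off the path would extend it. *)
  have := maxs (x :: v :: q); rewrite /= -szs -ltnNge; apply.
  apply: rooted_path_cons rvq xA _ _; first by rewrite sedge_sym.
  rewrite inE negb_or xq andbT.
  by apply/eqP=> E; rewrite E sedge_irrefl in vx.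
case: s rs maxs nbr_head => [|v [|u q]] // rs maxs nbr_head.
  have /and4P[_ /= /eqP vr _ _] := rs; rewrite {v}vr in rs maxs nbr_head.
  have r0 : [set r] != set0 by apply/set0Pn; exists r; rewrite inE.
  have rsub : [set r] \subset A by rewrite sub1set.
  have [|x [y [xr yA yr xy]]] := cutA [set r] rsub r0; first by rewrite eq_sym.
  rewrite !inE in xr yr; rewrite (eqP xr) in xy.
  by have := nbr_head r [::] y rs erefl yA xy => yr'; rewrite yr' eqxx in yr.
have /and4P[/= /andP[vu pq] lq uq /and3P[vA uA aq]] := rs.
have pvu : pendant A v u.
  by split=> // x xA vx; apply: (nbr_head v (u :: q) x rs erefl xA vx).
have vr : v != r.
  rewrite -(eqP lq); case/andP: uq => vuq _; apply: contra vuq => /eqP {1}->.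
  exact: mem_last.
exists v, u; split=> //.
case: q => [|w q] in rs maxs nbr_head pq lq uq aq *.
  left; have ur := eqP lq; rewrite /= in ur.
  have star x : x \in A -> x != r -> sedge r x.
    move=> xA xr; apply: contraT => rx.
    pose X := [set y in A | (y == r) || sedge r y].
    have XA : X \subset A by apply/subsetP=> y; rewrite inE => /andP[].
    have X0 : X != set0 by apply/set0Pn; exists r; rewrite inE rA eqxx.
    have XnA : X != A.
      apply: contraNneq rx => E; move: xA.
      by rewrite -E inE (negbTE xr) => /andP[].
    have [y [z [yX zA zX yz]]] := cutA X XA X0 XnA.
    move: yX zX; rewrite !inE zA /= negb_or => /andP[yA yr] /andP[zr rz].
    have {yr} ry : sedge r y.
      by case/orP: yr => // /eqP yr; rewrite yr (negbTE rz) in yz.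
    have yr : y != r by apply: contraTneq ry => ->; rewrite sedge_irrefl.
    have yz' : z != y by apply: contraTneq yz => ->; rewrite sedge_irrefl.
    (* z is at distance 2 from r, against the maximality of [:: v; r]. *)
    have := maxs [:: z; y; r]; apply; rewrite /= !inE negb_or yz' zr yr zA yA rA.
    by rewrite ![sedge _ r]sedge_sym [sedge z y]sedge_sym yz ry eqxx.
  have g1 : g <= 1.
    rewrite -(cards1 r); apply: gA; split; first by rewrite sub1set.
    move=> x xA; rewrite inE => xr; exists r; rewrite ?inE //.
    by rewrite sedge_sym star.
  have: dom_ge (A :\ v) 1 by apply: (@dom_ge1 _ r); rewrite !inE eq_sym vr.
  by move=> g1' D /g1'; apply: leq_trans.
have /= /andP[uw pq'] := pq; have /= /andP[wA aq'] := aq.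
have ur : u != r.
  move: lq uq => /= /eqP <- /and3P[_ uwq _]; apply: contra uwq => /eqP {1}->.
  exact: mem_last.
have vw : v != w by case/andP: uq; rewrite !inE !negb_or => /and3P[].
have [/existsP[x /and4P[xA ux xv xw]] | nox] :=
    boolP [exists x, [&& x \in A, sedge u x, x != v & x != w]].
  left; apply: (dom_ge_twin pvu (v' := x)) gA; last by rewrite eq_sym.
  have xuwq : x \notin u :: w :: q.
    apply/negP; rewrite inE => /orP[/eqP xu | xwq].
      by rewrite xu sedge_irrefl in ux.
    case/andP: uq => _ uq; case/negP: xw; apply/eqP.
    exact: (acyclic_head acG pq uq xwq ux).
  (* x in place of v gives another longest path, so x is pendant too. *)
  have rx : rooted_path A r (x :: u :: w :: q).
    apply: rooted_path_cons => //; last by rewrite sedge_sym.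
    have uq' : uniq (u :: w :: q) by case/andP: uq.
    by rewrite /rooted_path lq uq' pq /= uA wA.
  split=> //; first by rewrite sedge_sym.
  by move=> y yA xy; apply: (nbr_head _ _ _ rx).
right; exists w; split=> //.
  split=> //; rewrite ?inE ?wA ?uA ?andbT 1?eq_sym ?(pendant_neq pvu) //.
  move=> x; rewrite !inE => /andP[xv xA] ux; apply/eqP.
  apply: contraNT nox => xw; by apply/existsP; exists x; rewrite xA ux xv xw.
case: q => [|z q] in lq uq aq' pq' {rs maxs nbr_head pq aq} *; first by rewrite lq.
apply/orP; right; apply/existsP; exists z.
case/and3P: uq => _ + _; rewrite !inE !negb_or => /and3P[_ uz _].
by move: aq' pq'; rewrite /= eq_sym uz => /andP[-> _] /andP[-> _].
Qed.

(** The parameters of the bounds. Only a lower bound h + 1 on the domination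
    number is kept, and measuring the order by its excess k over 2 h + 1 keeps
    subtraction out of the exponents. *)
Definition dom_tree A h k :=
  [/\ connected A, dom_ge A h.+1 & #|A| = h + h + k.+1].

Section Induction.
Variables (r : G) (P : {set G} -> nat -> nat -> Prop).
Hypothesis P_root : P [set r] 0 0.
Hypothesis P_leaf : forall A v u h k, pendant A v u -> r \in A :\ v ->
  dom_tree (A :\ v) h k -> P (A :\ v) h k -> P A h k.+1.
Hypothesis P_path : forall A v u w h k,
  pendant A v u -> pendant (A :\ v) u w -> r \in A :\ v :\ u ->
  (w == r) || [exists z in A, (z != u) && sedge w z] ->
  dom_tree (A :\ v :\ u) h k -> P (A :\ v :\ u) h k -> P A h.+1 k.

(** The number k is produced rather than assumed, which proves on the way that
    the order is at least 2 h + 1. When h = 0 the second kind of step is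
    replaced by the first: deleting v alone leaves a nonempty set, whose
    domination number is at least 1. *)
Lemma peel_exists A h : acyclic G -> connected A -> r \in A -> dom_ge A h.+1 ->
  exists2 k, dom_tree A h k & P A h k.
Proof.
move=> acG; have [n] := ubnP #|A|; elim: n A h => // n IHn A h ltAn cA rA gA.
have [Ar | Ar] := eqVneq A [set r].
  have h0 : h = 0.
    have: h < #|[set r]|; last by rewrite cards1; case: (h).
    by apply: gA; rewrite Ar; split=> // x -> .
  exists 0; last by rewrite Ar h0.
  by split=> //; rewrite Ar h0 cards1.
have [v [u [pvu vr red]]] := peel acG cA rA Ar gA.
have [vA uA vu vN] := pvu.
have cAv : connected (A :\ v).
  have Av : A != [set v].
    apply: contraNneq vr => Av; move: rA; rewrite Av inE eq_sym.
    by move->.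
  by have [] := connected_del pvu (subxx A) vA cA Av.
have rAv : r \in A :\ v by rewrite !inE eq_sym vr.
have cardA : #|A| = #|A :\ v|.+1 by rewrite (cardsD1 v A) vA.
have leaf_case : dom_ge (A :\ v) h.+1 -> exists2 k, dom_tree A h k & P A h k.
  move=> gAv; have [|k tk Pk] := IHn (A :\ v) h _ cAv rAv gAv.
    by move: ltAn; rewrite cardA.
  exists k.+1; last exact: P_leaf pvu rAv tk Pk.
  by case: tk => _ _ tk; split=> //; rewrite cardA tk !addnS.
case: red => // -[w [ur puw wr]].
case: h => [|h] in gA leaf_case *; first by apply: leaf_case (dom_ge1 rAv).
have [uAv wAv uw uN] := puw.
have rAuv : r \in A :\ v :\ u by rewrite !inE [r == u]eq_sym ur eq_sym vr.
have cAuv : connected (A :\ v :\ u).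
  have Avu : A :\ v != [set u].
    apply: contraNneq ur => Avu; move: rAv; rewrite Avu inE eq_sym.
    by move->.
  by have [] := connected_del puw (subxx _) uAv cAv Avu.
have cardAv : #|A :\ v| = #|A :\ v :\ u|.+1 by rewrite (cardsD1 u (A :\ v)) uAv.
have [|k tk Pk] := IHn (A :\ v :\ u) h _ cAuv rAuv (dom_ge_path pvu gA).
  by move: ltAn; rewrite cardA cardAv ltnS => /ltnW.
exists k; last exact: P_path pvu puw rAuv wr tk Pk.
by case: tk => _ _ tk; split=> //; rewrite cardA cardAv tk !addSn !addnS.
Qed.

Lemma peel_ind A h k : acyclic G -> r \in A -> dom_tree A h k -> P A h k.
Proof.
move=> acG rA [cA gA cardA].
have [k' [_ _ cardA'] Pk'] := peel_exists acG cA rA gA.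
suff -> : k = k' by [].
by move: cardA'; rewrite cardA => /addnI[].
Qed.
End Induction.

(** * Upper bounds *)

(** Having at most one neighbour is inherited by subsets of A, while being a
    leaf is not (its neighbour may disappear); so M need not change when A
    shrinks. *)
Definition pendant_set A M := forall x y z, x \in M -> x \in A ->
  y \in A -> z \in A -> sedge x y -> sedge x z -> y = z.

Lemma pendant_setS A A' M : A' \subset A -> pendant_set A M -> pendant_set A' M.
Proof.
by move=> /subsetP A'A pM x y z xM xA yA zA; apply: pM; rewrite ?A'A.
Qed.

(** Both u and w have two neighbours in A, except for w when it is the root. *)
Lemma pendant_set_path A M r v u w : pendant_set A M -> r \notin M ->
  pendant A v u -> pendant (A :\ v) u w ->
  (w == r) || [exists z in A, (z != u) && sedge w z] ->
  u \notin M /\ w \notin M.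
Proof.
move=> pM rM [vA uA vu _] [_ wA uw _] wr.
have [{}wA wv] : w \in A /\ w != v by move: wA; rewrite !inE => /andP[].
split; apply/negP=> xM.
  by case/eqP: wv; apply: (pM u) => //; rewrite sedge_sym.
case/orP: wr => [/eqP wr | /existsP[z /and3P[zA zu wz]]].
  by rewrite -wr xM in rM.
by case/eqP: zu; apply: (pM w) => //; rewrite sedge_sym.
Qed.

Section Bounds.
Hypothesis acG : acyclic G.

Lemma rooted_all_bound A h k r : dom_tree A h k -> r \in A ->
  nsub [set r] A setT <= 3 ^ h * 2 ^ k.
Proof.
move=> tA rA; move: acG rA tA.
apply: (peel_ind (P := fun A h k => nsub [set r] A setT <= 3 ^ h * 2 ^ k)).
- by rewrite nsub_singleton // leq_b1.
- move=> {h k}A' v u h k pvu rA' _ IH.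
  rewrite (nsub_root_pendant _ pvu rA') inE /join_all.
  rewrite expnS mulnCA mul2n -addnn leq_add //.
  by apply: leq_trans IH; apply: leq_nsub (subsetUr _ _) (subxx _).
- move=> {h k}A' v u w h k pvu puw rA' _ _ IH.
  rewrite (nsub_root_path _ pvu puw rA') !inE /join_all /=.
  have leW := leq_trans (leq_nsub _ (subsetUr [set w] [set r]) (subxx _)) IH.
  by rewrite expnS -mulnA !mulSn mul0n addn0 -addnA !leq_add.
Qed.

(** With p the bound for the smaller tree, the first step gives at most
    (p - 2 ^ h) + p, and the second 2 (p - 2 ^ h) + p = 3 p - 2 ^ h.+1. *)
Lemma rooted_meet_bound A M h k r : dom_tree A h k -> r \in A ->
  r \notin M -> pendant_set A M ->
  nsub [set r] A M + 2 ^ h <= 3 ^ h * 2 ^ k.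
Proof.
move=> tA rA rM pM; move: acG rA tA pM.
pose P A h k := pendant_set A M -> nsub [set r] A M + 2 ^ h <= 3 ^ h * 2 ^ k.
apply: (peel_ind (P := P)); rewrite /P.
- by rewrite nsub_singleton // (negbTE rM).
- move=> {h k}A' v u h k pvu rA' tA' IH pM.
  rewrite (nsub_root_pendant _ pvu rA').
  have := IH (pendant_setS (subD1set _ _) pM).
  have := leq_trans (leq_nsub (A' :\ v) (subsetUr [set u] [set r])
    (subsetT (join_all (v \in M) M))) (rooted_all_bound tA' rA').
  by rewrite expnS mulnCA; move: (3 ^ h * 2 ^ k) => p; clear; lia.
- move=> {h k}A' v u w h k pvu puw rA' wr tA' IH pM.
  have [uM wM] := pendant_set_path pM rM pvu puw wr.
  rewrite (nsub_root_path _ pvu puw rA') (negbTE uM) orbF [join_all false _]/=.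
  have := IH (pendant_setS (subset_trans (subD1set _ _) (subD1set _ _)) pM).
  have := leq_nsub (A' :\ v :\ u) (subsetUr [set w] [set r]) (subxx M).
  have := leq_trans (leq_nsub (A' :\ v :\ u) (subsetUr [set w] [set r])
    (subsetT (join_all (v \in M) M))) (rooted_all_bound tA' rA').
  by rewrite !expnS -mulnA; move: (3 ^ h * 2 ^ k) => p; clear; lia.
Qed.

(** The first step adds the singleton of v and the sets through u; the second
    adds the three nonempty subsets of {u, v} and twice the sets through w. *)
Lemma all_bound A h k r : dom_tree A h k -> r \in A ->
  nsub set0 A setT <= 3 ^ h * 2 ^ k + 3 * h + k.
Proof.
move=> tA rA; move: acG rA tA.
pose P A h k := nsub set0 A setT <= 3 ^ h * 2 ^ k + 3 * h + k.
apply: (peel_ind (P := P)); rewrite /P.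
- by rewrite nsub_singleton ?sub0set // leq_b1.
- move=> {h k}A' v u h k pvu rA' tA'.
  have uA' : u \in A' :\ v.
    by case: (pvu) => _ uA _ _; rewrite !inE eq_sym (pendant_neq pvu).
  rewrite (nsub_all_pendant _ pvu) inE /join_all.
  have := rooted_all_bound tA' uA'.
  by rewrite expnS mulnCA; move: (3 ^ h * 2 ^ k) => p; clear; lia.
- move=> {h k}A' v u w h k pvu puw rA' wr tA'.
  have wA' : w \in A' :\ v :\ u.
    by case: (puw) => _ wA _ _; rewrite 2!inE eq_sym (pendant_neq puw).
  rewrite (nsub_all_path _ pvu puw) !inE /join_all /=.
  have := rooted_all_bound tA' wA'.
  by rewrite !expnS -mulnA; move: (3 ^ h * 2 ^ k) => p; clear; lia.
Qed.

(** As in [all_bound], except that in the second step u is unmarked: its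
    singleton does not count, and a set through u that avoids v must still meet
    M after u is deleted, hence falls under [rooted_meet_bound] with root w. *)
Lemma meet_bound A M h k r : dom_tree A h k -> r \in A ->
  r \notin M -> pendant_set A M ->
  nsub set0 A M + 2 ^ h <= 3 ^ h * 2 ^ k + 2 * h + k.
Proof.
move=> tA rA rM pM; move: acG rA tA pM.
pose P A h k := pendant_set A M ->
  nsub set0 A M + 2 ^ h <= 3 ^ h * 2 ^ k + 2 * h + k.
apply: (peel_ind (P := P)); rewrite /P.
- by rewrite nsub_singleton ?sub0set // (negbTE rM).
- move=> {h k}A' v u h k pvu rA' tA' IH pM.
  have uA' : u \in A' :\ v.
    by case: (pvu) => _ uA _ _; rewrite !inE eq_sym (pendant_neq pvu).
  rewrite (nsub_all_pendant _ pvu).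
  have := IH (pendant_setS (subD1set _ _) pM).
  have := leq_trans (leq_nsub (A' :\ v) (subxx [set u])
    (subsetT (join_all (v \in M) M))) (rooted_all_bound tA' uA').
  have := leq_b1 (v \in M).
  by rewrite expnS mulnCA; move: (3 ^ h * 2 ^ k) => p; clear; lia.
- move=> {h k}A' v u w h k pvu puw rA' wr tA' IH pM.
  have wA' : w \in A' :\ v :\ u.
    by case: (puw) => _ wA _ _; rewrite 2!inE eq_sym (pendant_neq puw).
  have [uM wM] := pendant_set_path pM rM pvu puw wr.
  rewrite (nsub_all_path _ pvu puw) (negbTE uM) orbF [join_all false _]/=.
  have pM' := pendant_setS (subset_trans (subD1set _ u) (subD1set _ v)) pM.
  have := IH pM'; have := rooted_meet_bound tA' wA' wM pM'.
  have := leq_trans (leq_nsub (A' :\ v :\ u) (subxx [set w])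
    (subsetT (join_all (v \in M) M))) (rooted_all_bound tA' wA').
  have := leq_b1 (v \in M).
  by rewrite !expnS -mulnA; move: (3 ^ h * 2 ^ k) => p; clear; lia.
Qed.

End Bounds.

(** * The whole tree *)

Definition leaves : {set G} := [set x : G | leaf x].

Lemma num_subtreesE : num_subtrees G = nsub set0 [set: G] setT.
Proof.
apply: eq_card => S; rewrite !inE sub0set subsetT /= -setI_eq0 setIT.
by case cS: (connected S) => //; case/andP: cS => ->.
Qed.

Lemma num_leaf_subtreesE : num_leaf_subtrees G = nsub set0 [set: G] leaves.
Proof.
apply: eq_card => S; rewrite !inE sub0set subsetT /=; congr (_ && _).
apply/exists_inP/pred0Pn => -[x].
  by move=> xS lx; exists x; rewrite /= inE xS.
by rewrite /= inE => /andP[xS lx]; exists x.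
Qed.

Lemma dominatingE D : dominating D <-> dominates setT D.
Proof.
split=> [/forallP domD | [_ domD]].
  split=> [|x _ xD]; first exact: subsetT.
  by have /implyP/(_ xD)/exists_inP := domD x.
apply/forallP=> x; apply/implyP=> xD; apply/exists_inP.
by apply: domD; rewrite ?inE.
Qed.

Lemma domination_number_ge g : dom_ge [set: G] g <-> g <= domination_number G.
Proof.
rewrite /domination_number.
case: arg_minnP => [|D domD minD].
  by apply/dominatingE; split=> // x; rewrite !inE.
split=> [|gD D' domD']; first by apply; apply/dominatingE.
by apply: leq_trans gD (minD _ _); apply/dominatingE.
Qed.

Lemma leafP x : reflect (exists y, forall z, sedge x z = (z == y)) (leaf x).
Proof.
apply: (iffP cards1P) => -[y xy]; exists y.
  by move=> z; move/setP: xy => /(_ z); rewrite !inE.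
by apply/setP=> z; rewrite !inE.
Qed.

Lemma pendant_set_leaves A : pendant_set A leaves.
Proof.
move=> x y z; rewrite inE => /leafP[t xt] _ _ _.
by rewrite !xt => /eqP-> /eqP->.
Qed.

(** Two adjacent leaves form a whole component. *)
Lemma nonleaf_ex : connected [set: G] -> 2 < #|G| -> exists r, r \notin leaves.
Proof.
move=> /connected_cutP[/set0Pn[v _] cutG] G2.
have [lv | lv] := boolP (v \in leaves); last by exists v.
move: lv; rewrite inE => /leafP[u vu]; exists u; apply/negP; rewrite inE.
case/leafP=> t ut; have := ut v; rewrite sedge_sym vu eqxx => /esym/eqP vt.
have X0 : [set v; u] != set0 by apply/set0Pn; exists v; rewrite !inE eqxx.
have XT : [set v; u] != setT.
  apply/eqP=> E; move: G2; rewrite -cardsT -E cards2; by case: eqP.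
have [x [y []]] := cutG _ (subsetT _) X0 XT.
rewrite !inE negb_or => xX _ /andP[yv yu] xy; move: xy.
by case/orP: xX => /eqP->; rewrite ?vu ?ut -?vt ?(negbTE yv) ?(negbTE yu).
Qed.

(** * Spiders attain the bounds *)

(** Equality in the four bounds. It holds for the tree made of a centre r with
    h legs of length 2 and k legs of length 1 when M is the set of their
    ends. *)
Definition spider_counts r A M h k :=
  [/\ nsub [set r] A setT = 3 ^ h * 2 ^ k,
      nsub [set r] A M + 2 ^ h = 3 ^ h * 2 ^ k,
      nsub set0 A setT = 3 ^ h * 2 ^ k + 3 * h + k &
      nsub set0 A M + 2 ^ h = 3 ^ h * 2 ^ k + 2 * h + k].

Lemma spider_counts1 r M : r \notin M -> spider_counts r [set r] M 0 0.
Proof.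
by move=> rM; split; rewrite nsub_singleton ?sub0set // ?inE // (negbTE rM).
Qed.

(** Since u = r, the sets through u and r are the sets through r, and no
    inequality is lost. *)
Lemma spider_counts_leaf r A M v h k : pendant A v r -> v \in M ->
  spider_counts r (A :\ v) M h k -> spider_counts r A M h k.+1.
Proof.
move=> pvr vM [E1 E2 E3 E4].
have rA : r \in A :\ v.
  by case: (pvr) => _ rA _ _; rewrite !inE eq_sym (pendant_neq pvr).
rewrite /spider_counts !(nsub_root_pendant _ pvr rA) !(nsub_all_pendant _ pvr).
rewrite inE vM /join_all setUid; move: E1 E2 E3 E4.
rewrite !expnS; move: (nsub _ _ _) (nsub _ _ _) (nsub _ _ _) (nsub _ _ _).
by clear; split; lia.
Qed.

(** The same with w = r. *)
Lemma spider_counts_path r A M v u h k :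
  pendant A v u -> pendant (A :\ v) u r -> v \in M -> u \notin M ->
  spider_counts r (A :\ v :\ u) M h k -> spider_counts r A M h.+1 k.
Proof.
move=> pvu pur vM uM [E1 E2 E3 E4].
have rA : r \in A :\ v :\ u.
  by case: (pur) => _ rA _ _; rewrite 2!inE eq_sym (pendant_neq pur).
rewrite /spider_counts !(nsub_root_path _ pvu pur rA).
rewrite !(nsub_all_path _ pvu pur).
rewrite !inE vM (negbTE uM) /join_all /= setUid; move: E1 E2 E3 E4.
rewrite !expnS; move: (nsub _ _ _) (nsub _ _ _) (nsub _ _ _) (nsub _ _ _).
by clear; split; lia.
Qed.

(** * Trees from a rank function *)

(** The two neighbours on a cycle of a vertex of maximal rank would be equal. *)
Lemma rank_acyclic (rank : G -> nat) :
  (forall x y z, sedge x y -> sedge x z -> rank y <= rank x ->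
     rank z <= rank x -> y = z) -> acyclic G.
Proof.
move=> rankN c c3; apply/negP=> /andP[cc uc].
have /hasP[x0 x0c _] : has predT c by rewrite has_predT; case: (c) c3.
have := arg_maxnP (P := [in c]) rank x0c.
case=> x xc maxx; case/rot_to: (xc) => i s Ei.
have: cycle (@sedge G) (x :: s) by rewrite -Ei rot_cycle.
have us : uniq (x :: s) by rewrite -Ei rot_uniq.
have ss : 1 < size s by move: c3; rewrite -(size_rot i) Ei.
have ms y : y \in s -> rank y <= rank x.
  by move=> ys; apply: maxx; rewrite /= -(mem_rot i) Ei inE ys orbT.
case: s => [|y s] // in us ss ms {Ei} *.
case/lastP: s => [|s z] // in us ss ms *.
rewrite /= rcons_path last_rcons => /and3P[xy _ zx].
move: us => /= /and3P[_ + _]; rewrite mem_rcons inE negb_or => /andP[/eqP + _].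
apply; apply: (rankN x) => //; first by rewrite sedge_sym.
  by rewrite ms ?mem_head.
by rewrite ms // inE mem_rcons mem_head orbT.
Qed.

(** On the side of a cut that misses r, a vertex of minimal rank has a lower
    neighbour, which lies on the other side. *)
Lemma rank_connected (rank : G -> nat) r :
  (forall x, x != r -> exists2 y, sedge x y & rank y < rank x) ->
  connected [set: G].
Proof.
move=> rankN; apply/connected_cutP; split; first by apply/set0Pn; exists r.
move=> X _ /set0Pn[a aX] XnT.
have [rX | rX] := boolP (r \in X).
  have [b bX] : exists b, b \in ~: X.
    by apply/set0Pn; apply: contra XnT => /eqP E; rewrite -[X]setCK E setC0.
  case: (arg_minnP (P := [in ~: X]) rank bX) => x; rewrite /= inE => xX minx.
  have [|y xy rxy] := rankN x; first by apply: contraNneq xX => ->.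
  exists y, x; rewrite inE sedge_sym; split=> //.
  by apply: contraLR rxy => yX; rewrite -leqNgt minx //= inE.
case: (arg_minnP (P := [in X]) rank aX) => x /= xX minx.
have [|y xy rxy] := rankN x; first by apply: contraNneq rX => <-.
exists x, y; rewrite inE; split=> //.
by apply: contraL rxy => yX; rewrite -leqNgt minx.
Qed.

End Trees.

(** * The tree A(n, gamma) *)

Section Extremal.
Variables h k : nat.
(* The condition n >= 2 gamma makes the excess over 2 h + 1 positive: it is
   k + 1 in this section. *)
Let n := h + h + k.+2.
Let c := h + k.+1.
Local Notation G := (A_graph n h.+1).
Implicit Types i j : G.

Lemma A_edgeE i j : sedge i j =
  [|| (i == 0 :> nat) && (0 < j <= c), (0 < i) && (j == i + c :> nat),
      (j == 0 :> nat) && (0 < i <= c) | (0 < j) && (i == j + c :> nat)].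
Proof.
rewrite /= /A_edge /A_arc /= -!orbA.
have -> : n - h.+1 = c by rewrite /n /c; lia.
have [-> | //] := eqVneq i j; rewrite /= /c; apply/esym/negbTE; lia.
Qed.

Lemma n_gt0 : 0 < n.
Proof. by rewrite /n; lia. Qed.
Let zero : G := Ordinal n_gt0.

Lemma A_connected : connected [set: G].
Proof.
apply: (rank_connected (rank := fun x : G => x : nat) (r := zero)) => x /eqP x0.
have {}x0 : x != 0 :> nat by apply/eqP=> E; case: x0; apply/val_inj.
have xn := ltn_ord x.
have [xc | xc] := leqP x c.
  by exists zero; rewrite ?A_edgeE /=; move: x0 xc; clear; lia.
have yn : x - c < n by move: xn; clear; lia.
by exists (Ordinal yn); rewrite ?A_edgeE /=;
  move: x0 xc xn; rewrite /n /c; clear; lia.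
Qed.

Lemma A_acyclic : acyclic G.
Proof.
apply: (rank_acyclic (rank := fun x : G => x : nat)) => x y z.
rewrite !A_edgeE /c => xy xz yx zx; apply/val_inj => /=.
by move: xy xz yx zx; clear; lia.
Qed.

(** The vertices 0, ..., h dominate. Conversely a dominating set meets each of
    the h + 1 disjoint pairs {i, i + c} with i <= h, because i is the only
    neighbour of i + c. *)
Lemma A_domination : domination_number G = h.+1.
Proof.
apply/eqP; rewrite eqn_leq; apply/andP; split.
  have hn : h.+1 <= n by rewrite /n; lia.
  rewrite leqNgt; apply/negP => /domination_number_ge.
  move=> /(_ [set widen_ord hn i | i in 'I_h.+1]).
  rewrite card_imset ?card_ord ?ltnn; last by move=> i j /(congr1 val) /= /val_inj.
  suff D x : x \notin [set widen_ord hn i | i in 'I_h.+1] ->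
      exists2 y, y \in [set widen_ord hn i | i in 'I_h.+1] & @sedge G x y.
    by move=> H; have := H (conj (subsetT _) (fun x _ => D x)).
  move=> xD; have xh : h < x.
    rewrite ltnNge; apply: contra xD => xh; apply/imsetP.
    by exists (Ordinal (xh : x < h.+1)) => //; apply/val_inj.
  have xn := ltn_ord x.
  have [xc | xc] := leqP x c.
    exists (widen_ord hn ord0); first exact: imset_f.
    by rewrite A_edgeE /=; move: xh xc; clear; lia.
  have yh : x - c < h.+1 by move: xn xc; rewrite /n /c; clear; lia.
  exists (widen_ord hn (Ordinal yh)); first exact: imset_f.
  by rewrite A_edgeE /=; move: xn xc xh; rewrite /n /c; clear; lia.
apply/domination_number_ge => D [_ domD].
have lo (i : 'I_h.+1) : i < n by have := ltn_ord i; rewrite /n; lia.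
have hi (i : 'I_h.+1) : i + c < n by have := ltn_ord i; rewrite /n /c; lia.
pose f (i : 'I_h.+1) : G :=
  if Ordinal (lo i) \in D then Ordinal (lo i) else Ordinal (hi i).
have finj : injective f.
  move=> i j fij; apply/val_inj; move: (ltn_ord i) (ltn_ord j) fij; rewrite /f.
  by case: ifP => _; case: ifP => _ ih jh /(congr1 val) /=;
    move: ih jh; rewrite /c; clear; lia.
rewrite -[h.+1]card_ord -(card_imset _ finj); apply/subset_leq_card/subsetP=> x.
case/imsetP=> i _ ->; rewrite /f; case: ifPn => // loD.
apply: contraR loD => hiD.
have [y yD] := domD (Ordinal (hi i)) (in_setT _) hiD.
rewrite A_edgeE /= => iy; suff <- : y = Ordinal (lo i) by [].
apply/val_inj; move: (ltn_ord i) (ltn_ord y) iy; rewrite /n /c /=; clear; lia.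
Qed.

(** The centre, a of the h legs of length 2 and b of the legs of length 1. *)
Definition part a b : {set G} :=
  [set i : G | [|| i <= a, h < i <= h + b | c < i <= c + a]].
Definition outer : {set G} := [set i : G | h < i].

Lemma part_leaf_step b : b <= k -> exists v : G,
  [/\ v \in outer, pendant (part 0 b.+1) v zero & part 0 b.+1 :\ v = part 0 b].
Proof.
move=> bk; have vn : h + b.+1 < n by move: bk; rewrite /n; clear; lia.
exists (Ordinal vn); split.
- by rewrite inE /=; move: bk; clear; lia.
- split=> [|||x]; rewrite ?inE ?A_edgeE /=;
    try by move: bk; rewrite /c; clear; lia.
  move=> xp vx; apply/val_inj => /=.
  by move: bk xp vx; rewrite /c; clear; lia.
apply/setP=> x; rewrite !inE -val_eqE /=.
by move: bk (ltn_ord x); rewrite /c /n; clear; lia.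
Qed.

Lemma part_path_step a : a < h -> exists v u : G,
  [/\ v \in outer, u \notin outer, pendant (part a.+1 k.+1) v u,
      pendant (part a.+1 k.+1 :\ v) u zero &
      part a.+1 k.+1 :\ v :\ u = part a k.+1].
Proof.
move=> ah.
have vn : c + a.+1 < n by move: ah; rewrite /n /c; clear; lia.
have un : a.+1 < n by move: ah; rewrite /n /c; clear; lia.
exists (Ordinal vn), (Ordinal un); split.
- by rewrite inE /=; move: ah; rewrite /c; clear; lia.
- by rewrite inE /=; move: ah; rewrite /c; clear; lia.
- split=> [|||x]; rewrite ?inE ?A_edgeE /=;
    try by move: ah; rewrite /c; clear; lia.
  move=> xp vx; apply/val_inj => /=.
  by move: ah xp vx (ltn_ord x); rewrite /n /c; clear; lia.
- split=> [|||x]; rewrite ?inE -?val_eqE ?A_edgeE /=;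
    try by move: ah; rewrite /n /c; clear; lia.
  move=> xp vx; apply/val_inj => /=.
  by move: ah xp vx (ltn_ord x); rewrite /n /c; clear; lia.
apply/setP=> x; rewrite !inE -!val_eqE /=.
by move: ah (ltn_ord x); rewrite /c /n; clear; lia.
Qed.

Lemma A_counts : spider_counts zero [set: G] outer h k.+1.
Proof.
have -> : [set: G] = part h k.+1.
  apply/setP=> x; rewrite !inE; move: (ltn_ord x); rewrite /n /c; clear; lia.
suff counts a : a <= h -> spider_counts zero (part a k.+1) outer a k.+1.
  exact: counts.
elim: a => [_ | a IHa ah].
  suff counts b : b <= k.+1 -> spider_counts zero (part 0 b) outer 0 b.
    exact: counts.
  elim: b => [_ | b IHb bk].
    have -> : part 0 0 = [set zero].
      by apply/setP=> x; rewrite !inE -val_eqE /= /c; clear; lia.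
    by apply: spider_counts1; rewrite inE /=.
  have [v [vM pv E]] := part_leaf_step bk.
  by apply: spider_counts_leaf pv vM _; rewrite E; apply: IHb (ltnW bk).
have [v [u [vM uM pv pu E]]] := part_path_step ah.
by apply: spider_counts_path pv pu vM uM _; rewrite E; apply: IHa (ltnW ah).
Qed.

Lemma outer_leaves : outer \subset leaves G.
Proof.
apply/subsetP=> x; rewrite !inE => hx; apply/leafP.
have [xc | xc] := leqP x c.
  exists zero => y; rewrite A_edgeE -val_eqE /=.
  by move: hx xc (ltn_ord x) (ltn_ord y); rewrite /n /c; clear; lia.
have yn : x - c < n by move: (ltn_ord x); clear; lia.
exists (Ordinal yn) => y; rewrite A_edgeE -val_eqE /=.
by move: hx xc (ltn_ord x) (ltn_ord y); rewrite /n /c; clear; lia.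
Qed.

End Extremal.

(** The tree K_2 is the one case where every vertex is a leaf and none can
    serve as an unmarked root. *)
Lemma A21_leaf (x : A_graph 2 1) : leaf x.
Proof.
apply/leafP; exists (rev_ord x) => y; rewrite -val_eqE /=.
by case: x => -[|[|x]] //= ?; case: y => -[|[|y]].
Qed.

Theorem theorem4p2 (n gamma : nat) (gamma_ge1 : 1 <= gamma)
    (n_ge : 2 * gamma <= n) :
  tree_class n gamma (A_graph n gamma) /\
  (forall T : sgraph, tree_class n gamma T ->
     num_subtrees T <= num_subtrees (A_graph n gamma) /\
     num_leaf_subtrees T <= num_leaf_subtrees (A_graph n gamma)).
Proof.
have [h [k [En Eg]]] : exists h k, n = h + h + k.+2 /\ gamma = h.+1.
  by exists gamma.-1, (n - 2 * gamma); split; lia.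
rewrite {}En {}Eg {n gamma gamma_ge1 n_ge}; split.
  split; [split; [exact: A_connected | exact: A_acyclic] | | exact: A_domination].
  by rewrite card_ord.
move=> T [[cT acT] cardT domT].
have tT : dom_tree [set: T] h k.+1.
  by split; rewrite ?cardsT //; apply/domination_number_ge; rewrite domT.
have [r0 _] : exists r, r \in [set: T] by apply/set0Pn; case/andP: cT.
have [_ _ EF EL] := A_counts h k.
have allT : num_subtrees T <= num_subtrees (A_graph (h + h + k.+2) h.+1).
  by rewrite !num_subtreesE EF (all_bound acT tT (in_setT r0)).
split=> //; have [hk | hk] := posnP (h + k).
  have [h0 k0] : h = 0 /\ k = 0 by move: hk; clear; lia.
  apply: leq_trans (leq_trans allT _).
    by apply/subset_leq_card/subsetP=> S; rewrite inE => /andP[].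
  rewrite h0 k0; apply/subset_leq_card/subsetP=> S cS; rewrite inE cS /=.
  have /andP[/set0Pn[x xS] _] : connected S by rewrite inE in cS.
  by apply/exists_inP; exists x; rewrite ?A21_leaf.
have [|r rL] := nonleaf_ex cT; first by rewrite cardT; move: hk; clear; lia.
have := meet_bound acT tT (in_setT r) rL (@pendant_set_leaves _ _).
rewrite !num_leaf_subtreesE -EL leq_add2r => /leq_trans -> //.
by apply: leq_nsub; rewrite ?sub0set ?outer_leaves.
Qed.
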